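(* Let $r\ge1$ be an integer, let $\mathscr C$ be a class of graphs with sub-exponential expansion, and for every integer $p\ge2$ let $g(p)$ be an integer such that every graph in $\mathscr C$ with girth at least $g(p)$ is $p$-path degenerate. Then for every $G\in\mathscr C$: (i) if $q$ is an integer with $r<q<2r$ and $\mathrm{girth}(G)\ge g(2q)$, then $\mathrm{wcol}_r(G)\le r+2+\left\lfloor\log_2\!\left(\frac{q-1}{q-r}\right)\right\rfloor$; (ii) if $\mathrm{girth}(G)\ge g(4r)$, then $\mathrm{wcol}_r(G)\le r+2$.
   Context: Graphs are finite and simple; the girth is the length of a shortest cycle. A strict ear of a graph $G$ is a path of $G$ whose internal vertices all have degree $2$ in $G$ and whose two endpoints are distinct. For an integer $p\ge1$, a $p$-reduction of $G$ is the deletion of either an isolated vertex, or a vertex of degree $1$, or the internal vertices of a strict ear of $G$ of length at least $p$. A graph is $p$-path degenerate if it can be reduced to the empty graph by a sequence of $p$-reductions. For a linear order $\pi$ of $V(G)$, $u$ is weakly $r$-reachable from $v$ if $u\le_\pi v$ and there is a $u$–$v$ path $P$ of length at most $r$ with $u<_\pi w$ for every internal vertex $w$ of $P$; $\mathrm{WReach}_r[G,\pi,v]$ is the set of such $u$, and $\mathrm{wcol}_r(G)=\min_{\pi}\max_{v\in V(G)}|\mathrm{WReach}_r[G,\pi,v]|$. A class $\mathscr C$ has sub-exponential expansion if $\sup\{\nabla_r(G):G\in\mathscr C\}=2^{o(r)}$, where $\nabla_r(G)$ is the maximum of $|E(H)|/|V(H)|$ over nonempty shallow minors $H$ of $G$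 at depth $r$ (minors obtained by contracting vertex-disjoint subgraphs of radius at most $r$ and deleting vertices and edges). *)

(* Defs.v *)
From HB Require Import structures.
From mathcomp Require Import all_boot.
From mathcomp Require Import fingroup perm.
From mathcomp Require Import boolp.

Set Implicit Arguments.
Unset Strict Implicit.
Unset Printing Implicit Defensive.

Record graph := Graph {
  V : finType;
  adj : rel V;
  adj_sym : symmetric adj;
  adj_irr : irreflexive adj }.

Section GraphDefs.
Variable G : graph.
Local Notation T := (V G).
Local Notation e := (@adj G).

Definition is_cycle (c : seq T) : bool := [&& 3 <= size c, uniq c & path.cycle e c].

(* girth(G) >= k  (vacuous for forests, whose girth is infinite) *)
Definition girth_ge (k : nat) : Prop := forall c, is_cycle c -> k <= size c.

Definition deg (A : {set T}) (v : T) : nat := #|[set u in A | e v u]|.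

(* x, mid, y is a strict ear of G[A]: a path x - mid - y of G[A] (all vertices
   distinct, so the endpoints x, y are distinct) whose internal vertices (those
   of mid) have degree 2 in G[A].  Its length is (size mid).+1. *)
Definition strict_ear (A : {set T}) (x : T) (mid : seq T) (y : T) : bool :=
  [&& all (mem A) (x :: rcons mid y), uniq (x :: rcons mid y),
      path e x (rcons mid y) & all (fun z => deg A z == 2) mid].

Inductive pdeg (p : nat) : {set T} -> Prop :=
| pdeg_empty : pdeg p set0
| pdeg_low (A : {set T}) (v : T) :
    v \in A -> deg A v <= 1 -> pdeg p (A :\ v) -> pdeg p A
| pdeg_ear (A : {set T}) (x : T) (mid : seq T) (y : T) :
    strict_ear A x mid y -> p <= (size mid).+1 ->
    pdeg p (A :\: [set z in mid]) -> pdeg p A.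

Definition path_degenerate (p : nat) : Prop := pdeg p [set: T].

Definition within_dist (A : {set T}) (c x : T) (r : nat) : Prop :=
  exists s : seq T, [/\ path e c s, last c s = x, all (mem A) (c :: s) & size s <= r].

Definition radius_le (A : {set T}) (r : nat) : Prop :=
  exists2 c, c \in A & forall x, x \in A -> within_dist A c x r.

End GraphDefs.

Definition shallow_minor (H G : graph) (r : nat) : Prop :=
  exists B : V H -> {set V G},
    [/\ forall a, radius_le (B a) r,
        forall a b, a != b -> [disjoint B a & B b]
      & forall a b, @adj H a b -> exists x y, [/\ x \in B a, y \in B b & @adj G x y]].

Definition nedges (H : graph) : nat :=
  #|[set p : V H * V H | @adj H p.1 p.2]| %/ 2.

(* sup_{G in C} nabla_r(G) = 2^{o(r)}: for every k >= 1, eventually in r,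
   every nonempty depth-r shallow minor H of a graph of C has
   |E(H)|/|V(H)| <= 2^(r/k), i.e. |E(H)|^k <= 2^r |V(H)|^k. *)
Definition subexp_expansion (C : graph -> Prop) : Prop :=
  forall k, 0 < k -> exists R, forall r, R <= r ->
    forall G, C G -> forall H, shallow_minor H G r -> 0 < #|V H| ->
      nedges H ^ k <= 2 ^ r * #|V H| ^ k.

Section Wcol.
Variable G : graph.
Local Notation T := (V G).
Local Notation e := (@adj G).

(* a linear order of V(G) is given by a permutation s: u <= v iff
   rank (s u) <= rank (s v) *)
Definition prank (s : {perm T}) (u : T) : nat := enum_rank (s u).

Definition wreach (s : {perm T}) (r : nat) (v u : T) : Prop :=
  prank s u <= prank s v /\
  (u = v \/ exists q : seq T,
     [/\ path e u (rcons q v), uniq (u :: rcons q v), (size q).+1 <= r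
       & all (fun w => prank s u < prank s w) q]).

Definition WReach (s : {perm T}) (r : nat) (v : T) : {set T} :=
  [set u | `[< wreach s r v u >] ].

Definition wcol (r : nat) : nat :=
  \big[minn/#|T|]_(s : {perm T}) \max_(v : T) #|WReach s r v|.

End Wcol.

(* Main.v *)
Require Import Defs.
From HB Require Import structures.
From mathcomp Require Import all_boot.
From mathcomp Require Import fingroup perm boolp zify.

Set Implicit Arguments.
Unset Strict Implicit.
Unset Printing Implicit Defensive.

(** Undo the reductions of a 2q-path degenerate graph, always placing the restored
    vertices after the old ones, and maintain |WReach_i(v)| <= reach_bound q i for
    every v and every i < q.  On a restored ear of length L >= 2q, the vertex at
    distance q from one end is made the smallest of the interior, and both arms
    increase from the endpoints towards it.  An ear vertex at distance d from its
    endpoint x then reaches at most d vertices of its arm, the center only if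
    q <= d + i, and WReach_(i-d)(x); when the center is reached, (q-1)/(q-(i-d)) is
    at most half of (q-1)/(q-i), which pays for it.  *)

Lemma bigmin_seq_le (I : eqType) (x : nat) (s : seq I) (F : I -> nat) i :
  i \in s -> \big[minn/x]_(j <- s) F j <= F i.
Proof.
elim: s => // j s IH; rewrite inE big_cons => /predU1P[-> | /IH le_i].
  exact: geq_minl.
exact: leq_trans (geq_minr _ _) le_i.
Qed.

(** * Linear orders from injective rank functions *)

Section RankPerm.
Variables (T : finType) (rk : T -> nat).
Hypothesis rk_inj : injective rk.

Let below u := #|[set w | rk w < rk u]|.

Let below_lt u : below u < #|T|.
Proof.
rewrite -cardsT; apply: proper_card; apply/properP; split; first exact: subsetT.
by exists u; rewrite !inE ?ltnn.
Qed.

Let ltn_below u v : (below u < below v) = (rk u < rk v).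
Proof.
have mono a b : rk a <= rk b -> below a <= below b.
  move=> le_ab; apply: subset_leq_card; apply/subsetP => w; rewrite !inE => lt_wa.
  exact: leq_trans lt_wa le_ab.
case: (ltnP (rk u) (rk v)) => [lt_uv | /mono]; last by rewrite leqNgt => /negbTE.
apply: proper_card; apply/properP; split; last by exists u; rewrite !inE ?ltnn.
by apply/subsetP => w; rewrite !inE => /ltn_trans; apply.
Qed.

(** An order is read off a permutation through [enum_rank], so [u] is sent to the element whose
    index in the enumeration is the number of elements ranked below [u]. *)
Let place u : T := enum_val (Ordinal (below_lt u)).

Let place_inj : injective place.
Proof.
move=> u v /enum_val_inj[eq_uv]; apply: rk_inj.
by move: (ltn_below u v) (ltn_below v u); rewrite eq_uv ltnn; case: ltngtP.
Qed.

Definition rank_perm : {perm T} := perm place_inj.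

Lemma ltn_rank_perm u v :
  (enum_rank (rank_perm u) < enum_rank (rank_perm v)) = (rk u < rk v).
Proof. by rewrite !permE !enum_valK ltn_below. Qed.

End RankPerm.

(** * Weak reachability through walks *)

Section WeakReach.
Variables (T : finType) (e : rel T).
Implicit Types (A : {set T}) (rk : T -> nat).

(* Walks replace paths: this contains (in fact equals) the set of vertices
   weakly [i]-reachable from [v] in [G[A]], and it unfolds along the first step. *)
Fixpoint wset rk A i v : {set T} :=
  if i is j.+1 then
    v |: [set u | (rk u < rk v) && [exists w in A, e v w && (u \in wset rk A j w)]]
  else [set v].

Lemma wsetSP rk A i v u :
  reflect (u = v \/ rk u < rk v /\ exists w, [/\ w \in A, e v w & u \in wset rk A i w])
          (u \in wset rk A i.+1 v).
Proof.
rewrite /= in_setU1 inE; apply: (iffP predU1P).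
  case=> [-> | /andP[lt_uv /existsP[w /and3P[wA evw uW]]]]; first by left.
  by right; split=> //; exists w.
case=> [-> | [lt_uv [w [wA evw uW]]]]; first by left.
by right; rewrite lt_uv; apply/existsP; exists w; rewrite wA evw.
Qed.

Lemma wset_refl rk A i v : v \in wset rk A i v.
Proof. by case: i => [|i]; rewrite /= !inE eqxx. Qed.

Lemma wset_rank rk A i v u : u \in wset rk A i v -> u = v \/ rk u < rk v.
Proof.
case: i => [/set1P-> | i /wsetSP[-> | []]]; by [left | right].
Qed.

Lemma wset_mono rk A i j v : i <= j -> wset rk A i v \subset wset rk A j v.
Proof.
elim: i j v => [|i IH] j v; first by rewrite /= sub1set wset_refl.
case: j => // j.
move=> le_ij; apply/subsetP=> u /wsetSP[-> | [lt_uv [w [wA evw uW]]]].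
  exact: wset_refl.
by apply/wsetSP; right; split=> //; exists w; split=> //; apply: (subsetP (IH _ _ le_ij)).
Qed.

End WeakReach.

Lemma WReach_sub_wset (G : graph) (rk : V G -> nat) (rk_inj : injective rk) r v :
  WReach (rank_perm rk_inj) r v \subset wset (@adj G) rk setT r v.
Proof.
apply/subsetP=> u; rewrite inE => /asboolP[le_uv [-> | [s [ps us le_s lt_s]]]].
  exact: wset_refl.
have {le_uv} lt_uv : rk u < rk v.
  have neq_uv : u != v by case/andP: us; rewrite mem_rcons inE negb_or => /andP[].
  rewrite ltnNge leq_eqVlt -(ltn_rank_perm rk_inj) -/(prank _ _) -/(prank _ _).
  by rewrite ltnNge le_uv orbF (inj_eq rk_inj) eq_sym.
have {us} : all (fun w => rk u < rk w) s.
  by apply: sub_all lt_s => w; rewrite /prank ltn_rank_perm.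
(* The path runs from [u] to [v] whereas [wset] unfolds at [v], so the induction strips the internal
   vertex next to [v]. *)
elim/last_ind: s v r ps le_s {lt_s} lt_uv => [|s w IH] v r.
  rewrite /= andbT; case: r => // r euv _ lt_uv _; apply/wsetSP; right; split=> //.
  by exists u; rewrite inE adj_sym wset_refl.
rewrite size_rcons rcons_path last_rcons all_rcons => /andP[ps ewv].
case: r => // r le_s lt_uv /andP[lt_uw lt_s]; apply/wsetSP; right; split=> //.
by exists w; rewrite inE adj_sym ewv; split=> //; apply: IH.
Qed.

Lemma wcol_le (G : graph) (rk : V G -> nat) r n :
    injective rk -> (forall v, #|wset (@adj G) rk setT r v| <= n) ->
  wcol G r <= n.
Proof.
move=> rk_inj bnd; apply: leq_trans (bigmin_seq_le _ _ (mem_index_enum (rank_perm rk_inj))) _.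
apply/bigmax_leqP=> v _; apply: leq_trans (bnd v).
exact/subset_leq_card/WReach_sub_wset.
Qed.

(** * Arithmetic of the bound, and the count on one arm of an ear *)

Definition reach_bound q i :=
  if i is 0 then 1 else i + 2 + trunc_log 2 ((q - 1) %/ (q - i)).

Lemma reach_bound_gt0 q i : 0 < reach_bound q i.
Proof. by case: i => // i; rewrite /= addnS. Qed.

Lemma reach_bound_step q i : i.+1 < q -> (reach_bound q i).+1 <= reach_bound q i.+1.
Proof.
case: i => [|i] lt_iq; first by rewrite /= addnS.
rewrite /reach_bound; have : (q - 1) %/ (q - i.+1) <= (q - 1) %/ (q - i.+2).
  by apply: leq_div2l; lia.
move/(leq_trunc_log 2); lia.
Qed.

(* An ear vertex that is close enough to the center to reach it is so far from
   the endpoint that the logarithm in the endpoint's bound drops by one. *)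
Lemma reach_bound_far q d i :
  0 < d < i -> i < q -> d + (q <= d + i) + reach_bound q (i - d) <= reach_bound q i.
Proof.
move=> /andP[d_gt0 lt_di] lt_iq.
case def_j: (i - d) => [|j]; first by lia.
case: i lt_di lt_iq def_j => // i lt_di lt_iq def_j; rewrite /reach_bound.
set a := (q - 1) %/ (q - j.+1); set b := (q - 1) %/ (q - i.+1).
have le_ab : a <= b by apply: leq_div2l; lia.
have := leq_trunc_log 2 le_ab.
case: (leqP q (d + i.+1)) => [le_q | _] _; last by move: (leq_trunc_log 2 le_ab); lia.
(* Doubling raises the truncated logarithm only for a positive argument. As [d] is at least
   [q - i.+1], the denominator in [a] is at least twice the one in [b], whence [2 * a <= b]. *)
have a_gt0 : 0 < a by rewrite divn_gt0; lia.
have le_2ab : 2 * a <= b.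
  rewrite leq_divRL; last by lia.
  have := leq_divM (q - 1) (q - j.+1); rewrite -/a; nia.
have := leq_trunc_log 2 le_2ab; rewrite trunc_logMp //; lia.
Qed.

(** Serves both arms: positions are counted from the endpoint of the arm, [d] is the position of the
    ear vertex and [m] that of the center [c], and [X j] stands for what the endpoint reaches within
    [j] steps. *)
Lemma ear_count (T : finType) (q d m i : nat) (p : nat -> T) (c : T)
    (X : nat -> {set T}) (S : {set T}) :
    0 < d -> q <= m -> d < m -> i < q ->
    (forall j, j <= i -> #|X j| <= reach_bound q j) ->
    (forall u, u \in S -> [\/ exists k, [/\ 0 < k <= d, d <= k + i & u = p k],
       u = c /\ m <= d + i | d <= i /\ u \in X (i - d)]) ->
  #|S| <= reach_bound q i.
Proof.
move=> d_gt0 le_qm lt_dm lt_iq bndX bndS.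
pose S1 := [set u in [seq p (d - j) | j <- iota 0 (minn d i.+1)]].
pose S2 := if m <= d + i then [set c] else set0.
pose S3 := if d <= i then X (i - d) else set0.
have sub : S \subset S1 :|: S2 :|: S3.
  apply/subsetP=> u /bndS; rewrite !inE.
  case=> [[k [k_d le_dk ->]] | [-> le_m] | [le_d uX]].
  - by rewrite (_ : _ \in map _ _) //; apply/mapP; exists (d - k);
      rewrite ?mem_iota; [lia | congr p; lia].
  - by rewrite /S2 le_m set11 orbT.
  - by rewrite /S3 le_d uX orbT.
have c1 : #|S1| <= minn d i.+1.
  by rewrite cardsE (leq_trans (card_size _)) // size_map size_iota.
have c2 : #|S2| = (m <= d + i) by rewrite /S2; case: ifP; rewrite ?cards1 ?cards0.
have {sub} cS : #|S| <= minn d i.+1 + (m <= d + i) + #|S3|.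
  apply: leq_trans (subset_leq_card sub) _; rewrite -c2.
  apply: leq_trans (leq_card_setU _ _) _; rewrite leq_add2r.
  by apply: leq_trans (leq_card_setU _ _) _; rewrite leq_add2r.
have le_mq : (m <= d + i) <= (q <= d + i).
  by case: (leqP m _) => // le_m; rewrite (leq_trans le_qm le_m).
apply: leq_trans cS _; rewrite /S3.
have := bndX _ (leq_subr d i).
case: (ltngtP d i) => [lt_di | lt_id | eq_di] bnd.
- have d_int : 0 < d < i by rewrite d_gt0.
  have := reach_bound_far d_int lt_iq; lia.
(* The endpoint is out of range, leaving at most [i + 1] arm vertices and the center. For [i = 0]
   the center is out of range too, since [d < m]. *)
- rewrite cards0; case: i lt_id lt_iq {le_mq bnd bndX bndS S1 c1 S2 c2 S3} => [|i] lt_id lt_iq /=.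
    by case: leqP; lia.
  by case: leqP; lia.
(* Here the value 1 of [reach_bound] at radius 0 matters: [i] arm vertices, the center and the
   endpoint alone make [i + 2]. *)
- move: bnd; rewrite -eq_di subnn /reach_bound; case: (d) d_gt0 => // j _.
  by case: leqP; lia.
Qed.

Lemma wset_sub (T : finType) (e : rel T) rk (A : {set T}) i v :
  v \in A -> wset e rk A i v \subset A.
Proof.
elim: i v => [|i IH] v vA; first by rewrite /= sub1set.
apply/subsetP=> u /wsetSP[-> // | [_ [w [wA _]]]]; exact/subsetP/IH.
Qed.

(** * Restoring a vertex of degree at most 1 *)

Section AddPendant.
Variables (T : finType) (e : rel T) (A : {set T}) (v : T) (rk rk' : T -> nat).
Hypotheses (e_sym : symmetric e) (e_irr : irreflexive e) (vA : v \in A).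
Hypothesis nb_v : forall x y, x \in A -> y \in A -> e v x -> e v y -> x = y.
Hypothesis rk_old : {in A :\ v, rk' =1 rk}.
Hypothesis rk_new : forall w, w \in A :\ v -> rk' w < rk' v.

Let W := wset e rk (A :\ v).
Let W' := wset e rk' A.

(** A walk from an old vertex cannot end at [v], which has the largest rank, and can leave [v] only
    to the neighbor it came from. Cutting out this detour saves two steps, hence the strong
    induction. *)
Lemma wset_pendant_old i w : w \in A :\ v -> W' i w \subset W i w.
Proof.
elim/ltn_ind: i w => -[|i] IH w wA'; first by [].
apply/subsetP=> u /wsetSP[-> | [lt_uw [x [xA ewx uW]]]]; first exact: wset_refl.
have uA : u \in A by exact: (subsetP (wset_sub _ _ _ xA)) uW.
have uv : u != v by apply: contraTneq lt_uw => ->; rewrite -leqNgt ltnW ?rk_new.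
have uA' : u \in A :\ v by rewrite in_setD1 uv.
case: (eqVneq x v) => [def_x | neq_x].
  case: i IH uW => [|i] IH; rewrite def_x; first by move/set1P=> def_u; rewrite def_u eqxx in uv.
  case/wsetSP=> [def_u | [_ [y [yA evy uW]]]]; first by rewrite def_u eqxx in uv.
  have wA : w \in A by case/setD1P: wA'.
  have eq_yw : y = w by apply: nb_v => //; rewrite e_sym -def_x.
  rewrite eq_yw in uW; have /subsetP mono := wset_mono e rk (A :\ v) w (leqW (leqnSn i)).
  by apply/mono; apply: (subsetP (IH i (leqnSn _) w wA')).
apply/wsetSP; right; rewrite -!rk_old //; split=> //.
have xA' : x \in A :\ v by rewrite in_setD1 neq_x.
by exists x; split=> //; apply: (subsetP (IH i _ x xA')).
Qed.

(** Old vertices gain nothing; [v] reaches itself and what its only neighbor reaches with one step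
    less, which [reach_bound_step] absorbs. *)
Lemma card_wset_pendant q i : i < q ->
    (forall j w, j <= i -> w \in A :\ v -> #|W j w| <= reach_bound q j) ->
  forall w, w \in A -> #|W' i w| <= reach_bound q i.
Proof.
move=> lt_iq bnd w wA; case: (eqVneq w v) => [-> | neq_wv]; last first.
  have wA' : w \in A :\ v by rewrite in_setD1 neq_wv.
  exact: leq_trans (subset_leq_card (wset_pendant_old i wA')) (bnd _ _ _ wA').
case: i lt_iq bnd => [|i] lt_iq bnd; first by rewrite /W' /= cards1.
case: (pickP [pred x in A | e v x]) => [x /andP[xA evx] | no_nb].
  have xA' : x \in A :\ v.
    by rewrite in_setD1 xA andbT; apply: contraTneq evx => ->; rewrite e_irr.
  have sub : W' i.+1 v \subset v |: W i x.
    apply/subsetP=> u /wsetSP[-> | [_ [y [yA evy uW]]]]; first exact: setU11.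
    rewrite (nb_v yA xA evy evx) in uW; apply: setU1r.
    exact: (subsetP (wset_pendant_old i xA')).
  apply: leq_trans (subset_leq_card sub) (leq_trans _ (reach_bound_step lt_iq)).
  by rewrite cardsU1; have := bnd i x (leqnSn i) xA'; case: (_ \notin _); lia.
have sub : W' i.+1 v \subset [set v].
  apply/subsetP=> u /wsetSP[-> | [_ [y [yA evy _]]]]; first exact: set11.
  by have := no_nb y; rewrite /= yA evy.
by apply: leq_trans (subset_leq_card sub) _; rewrite cards1 reach_bound_gt0.
Qed.

End AddPendant.

(** * Restoring the interior of an ear *)

Section AddEar.
Variables (T : finType) (e : rel T) (A A' : {set T}) (rk rk' : T -> nat).
Variables (p : nat -> T) (L m : nat).
Hypotheses (e_sym : symmetric e) (m_int : 0 < m < L).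
Hypotheses (p0_old : p 0 \in A') (pL_old : p L \in A').
Hypothesis p_new : forall k, 0 < k < L -> p k \notin A'.
Hypothesis A_cases : forall u, u \in A -> u \in A' \/ exists2 k, 0 < k < L & u = p k.
Hypothesis A'_sub : A' \subset A.
Hypothesis p_in : forall k, 0 < k < L -> p k \in A.
Hypothesis p_nbr : forall k w, 0 < k < L -> w \in A -> e (p k) w -> w = p k.-1 \/ w = p k.+1.
Hypothesis rk_old : {in A', rk' =1 rk}.
Hypothesis rk_new : forall k w, 0 < k < L -> w \in A' -> rk' w < rk' (p k).
Hypothesis rk_center : forall k, 0 < k < L -> rk' (p m) <= rk' (p k).
Hypothesis rk_left : forall j k, 0 < j < m -> 0 < k < m -> rk' (p j) < rk' (p k) -> j < k.
Hypothesis rk_right : forall j k, m < j < L -> m < k < L -> rk' (p j) < rk' (p k) -> k < j.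

Let W := wset e rk A'.
Let W' := wset e rk' A.

Lemma old_of_rank i d w u : 0 < d < L -> w \in A' -> rk' u < rk' w ->
  u \in W' i (p d) -> u \in A'.
Proof.
move=> d_int wA' lt_uw /(subsetP (wset_sub _ _ _ (p_in d_int)))/A_cases[] // [k k_int def_u].
by move: lt_uw; rewrite def_u ltnNge ltnW ?rk_new.
Qed.

(** Since ranks grow towards the center within each arm, a reached ear vertex other than the start
    and the center lies between the start and the endpoint of its arm. The inequalities for the
    center say that [d] and [m] differ by at most [i]. *)
Let ear_near i d k :=
  0 < k < L /\
  [\/ k = d, k = m /\ m <= d + i <= m + i + i, k <= d < m /\ d <= k + i
    | m < d <= k /\ k <= d + i].

Lemma wset_ear i : i < L ->
  (forall w, w \in A' -> W' i w \subset W i w) /\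
  (forall d u, 0 < d < L -> u \in W' i (p d) ->
     [\/ exists2 k, ear_near i d k & u = p k,
         d <= i /\ u \in W (i - d) (p 0)
       | L - d <= i /\ u \in W (i - (L - d)) (p L)]).
Proof.
elim: i => [|i IH] lt_iL.
  split=> [w _ | d u d_int /set1P->]; first by [].
  by constructor 1; exists d => //; split=> //; constructor 1.
have [IHold IHear] := IH (ltnW lt_iL).
split=> [w wA' | d u d_int].
  apply/subsetP=> u /wsetSP[-> | [lt_uw [x [xA ewx uW]]]]; first exact: wset_refl.
  case: (A_cases xA) => [xA' | [d d_int def_x]].
    have uA' : u \in A' by apply: (subsetP (wset_sub _ _ _ xA')) (subsetP (IHold x xA') _ uW).
    apply/wsetSP; right; rewrite -!rk_old //; split=> //.
    by exists x; split=> //; apply: (subsetP (IHold x xA')).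
  rewrite def_x in ewx uW; have uA' := old_of_rank d_int wA' lt_uw uW.
  (* An old neighbor of an interior vertex must be the adjacent end of the ear. *)
  have ends : d = 1 /\ w = p 0 \/ d = L.-1 /\ w = p L.
    have wA := subsetP A'_sub _ wA'.
    have inner k : k <= L -> w = p k -> k = 0 \/ k = L.
      move=> le_kL def_w; case: (posnP k); first by left.
      move=> k_gt0; right; apply/eqP; rewrite eqn_leq le_kL leqNgt.
      by apply: contraTN wA' => lt_kL; rewrite def_w p_new ?k_gt0.
    move: ewx; rewrite e_sym => /(p_nbr d_int wA)[] def_w.
      have le_dL : d.-1 <= L by clear - d_int; lia.
      case: (inner _ le_dL def_w) => d0; last by clear - d_int d0; lia.
      by left; rewrite def_w d0; split=> //; clear - d_int d0; lia.
    have le_dL : d.+1 <= L by clear - d_int; lia.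
    case: (inner _ le_dL def_w) => d0; first by [].
    by right; rewrite def_w d0; split=> //; clear - d0; lia.
  (* The excursion into the ear either comes back to [w] with fewer steps left, or reaches the
     opposite end, for which the length is too small. *)
  case: (IHear d u d_int uW) => [[k [k_int _] def_u] | [le_d uW0] | [le_d uWL]].
  - by rewrite def_u (negbTE (p_new k_int)) in uA'.
  - case: ends => [[_ ->] | [d_eq _]]; last by clear - d_eq le_d lt_iL; lia.
    apply: (subsetP (wset_mono _ _ _ _ _)) uW0.
    exact: leq_trans (leq_subr d i) (leqnSn i).
  - case: ends => [[d_eq _] | [_ ->]]; first by clear - d_eq le_d lt_iL; lia.
    apply: (subsetP (wset_mono _ _ _ _ _)) uWL.
    exact: leq_trans (leq_subr _ i) (leqnSn i).
case/wsetSP=> [-> | [lt_u [w [wA edw uW]]]].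
  by constructor 1; exists d => //; split=> //; constructor 1.
case: (p_nbr d_int wA edw) => def_w; rewrite {}def_w in uW.
- case: (posnP d.-1) => [d0 | d_gt1].
    constructor 2; split; first lia.
    move: uW; rewrite d0 => /(subsetP (IHold _ p0_old)).
    by rewrite (_ : i.+1 - d = i); lia.
  have d'_int : 0 < d.-1 < L by lia.
  case: (IHear _ _ d'_int uW) => [[k [k_int near] def_u] | [le_d uW0] | [le_d uWL]].
  (* The target must also rank below [p d]. This rules out starting at the center, and targets
     strictly between [p d] and the center. *)
  + constructor 1; exists k => //; split=> //; rewrite def_u in lt_u.
    have {near} [def_k|[def_k /andP[? ?]]|[/andP[? ?] ?]|[/andP[? ?] ?]] := near.
    * rewrite def_k in k_int lt_u *; case: (ltngtP d m) => [lt_dm | lt_md | eq_dm].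
      - by constructor 3; lia.
      - case: (ltnP m d.-1) => [lt_md' | le_md'].
          have: d < d.-1 by apply: rk_right => //; lia.
          lia.
        by constructor 2; lia.
      - by have := rk_center d'_int; rewrite -eq_dm leqNgt lt_u.
    * by constructor 2; lia.
    * case: (ltnP d m) => [lt_dm | le_md]; first by constructor 3; lia.
      have def_m : m = d by lia.
      by have := rk_center k_int; rewrite def_m leqNgt lt_u.
    * case: (leqP d k) => [le_dk | lt_kd]; first by constructor 4; lia.
      have: d < k by apply: rk_right => //; lia.
      lia.
  + constructor 2; split; first lia.
    by rewrite (_ : i.+1 - d = i - d.-1) //; lia.
  + constructor 3; split; first lia.
    by apply: (subsetP (wset_mono _ _ _ _ _)) uWL; lia.
- case: (ltnP d.+1 L) => [lt_dL | le_Ld]; last first.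
    have eq_dL : d.+1 = L by lia.
    constructor 3; split; first lia.
    move: uW; rewrite eq_dL => /(subsetP (IHold _ pL_old)).
    by rewrite (_ : i.+1 - _ = i); lia.
  have d'_int : 0 < d.+1 < L by lia.
  case: (IHear _ _ d'_int uW) => [[k [k_int near] def_u] | [le_d uW0] | [le_d uWL]].
  + constructor 1; exists k => //; split=> //; rewrite def_u in lt_u.
    have {near} [def_k|[def_k /andP[? ?]]|[/andP[? ?] ?]|[/andP[? ?] ?]] := near.
    * rewrite def_k in k_int lt_u *; case: (ltngtP d m) => [lt_dm | lt_md | eq_dm].
      - case: (ltnP d.+1 m) => [lt_md' | le_md'].
          have: d.+1 < d by apply: rk_left => //; lia.
          lia.
        by constructor 2; lia.
      - by constructor 4; lia.
      - by have := rk_center d'_int; rewrite -eq_dm leqNgt lt_u.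
    * by constructor 2; lia.
    * case: (leqP k d) => [le_dk | lt_kd]; first by constructor 3; lia.
      have: k < d by apply: rk_left => //; lia.
      lia.
    * case: (ltnP m d) => [lt_dm | le_md]; first by constructor 4; lia.
      have def_m : m = d by lia.
      by have := rk_center k_int; rewrite def_m leqNgt lt_u.
  + constructor 2; split; first lia.
    by apply: (subsetP (wset_mono _ _ _ _ _)) uW0; lia.
  + constructor 3; split; first lia.
    by rewrite (_ : i.+1 - (L - d) = i - (L - d.+1)) //; lia.
Qed.

(** Both arms have length at least [q > i], so a vertex of one arm never reaches the far endpoint
    and [ear_count] applies, with positions mirrored by [L - k] on the right arm. *)
Lemma card_wset_ear q i : q <= m -> q <= L - m -> i < q ->
    (forall j w, j <= i -> w \in A' -> #|W j w| <= reach_bound q j) ->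
  forall w, w \in A -> #|W' i w| <= reach_bound q i.
Proof.
move=> le_qm le_qLm lt_iq bnd w wA.
have lt_iL : i < L by lia.
have [sub_old sub_ear] := wset_ear lt_iL.
case: (A_cases wA) => [wA' | [d d_int ->]].
  exact: leq_trans (subset_leq_card (sub_old w wA')) (bnd _ _ (leqnn i) wA').
case: (ltngtP d m) => [lt_dm | lt_md | eq_dm].
- apply: (@ear_count _ q d m i p (p m) (W ^~ (p 0))) => //.
  + by case/andP: d_int.
  + by move=> j le_ji; apply: bnd.
  move=> u /(sub_ear d u d_int)[[k [k_int near] ->] | [le_d uW0] | [le_d uWL]].
  + case: near => [->|[-> /andP[? ?]]|[/andP[? ?] ?]|[/andP[? ?] ?]].
    * by constructor 1; exists d; split=> //; lia.
    * by constructor 2.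
    * by constructor 1; exists k; split=> //; lia.
    * lia.
  + by constructor 3.
  + lia.
- apply: (@ear_count _ q (L - d) (L - m) i (fun k => p (L - k)) (p m) (W ^~ (p L))) => //; try lia.
  + by move=> j le_ji; apply: bnd.
  move=> u /(sub_ear d u d_int)[[k [k_int near] ->] | [le_d uW0] | [le_d uWL]].
  + case: near => [->|[-> /andP[? ?]]|[/andP[? ?] ?]|[/andP[? ?] ?]].
    * by constructor 1; exists (L - d); split; [lia | lia | congr p; lia].
    * by constructor 2; split=> //; lia.
    * lia.
    * by constructor 1; exists (L - k); split; [lia | lia | congr p; lia].
  + lia.
  + by constructor 3.
(* The center has the least rank in the interior and both ends are out of range, so it reaches only
   itself. *)
- have sub : W' i (p d) \subset [set p d].
    apply/subsetP=> u /(sub_ear d u d_int)[[k [k_int near] ->] | [le_d uW0] | [le_d uWL]].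
    + case: near => [->|[-> _]|[/andP[? ?] ?]|[/andP[? ?] ?]]; rewrite -?eq_dm ?set11 //; lia.
    + lia.
    + lia.
  by apply: leq_trans (subset_leq_card sub) _; rewrite cards1 reach_bound_gt0.
Qed.

End AddEar.

(** * Building the order along the reductions *)

Lemma strict_ear_nbr (G : graph) (A : {set V G}) x mid y k w :
    strict_ear A x mid y -> 0 < k < (size mid).+1 -> w \in A ->
    let p := nth x (x :: rcons mid y) in
  adj (p k) w -> w = p k.-1 \/ w = p k.+1.
Proof.
case/and4P=> sA sU sP sD k_int wA p ekw.
have sz : size (x :: rcons mid y) = (size mid).+2 by rewrite /= size_rcons.
have pA j : j < (size mid).+2 -> p j \in A.
  by move=> lt_j; apply: (allP sA); rewrite mem_nth ?sz.
have step j : j < (size mid).+1 -> adj (p j) (p j.+1).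
  by move=> lt_j; move/(pathP x): sP; apply; rewrite size_rcons.
have deg_k : deg A (p k) == 2.
  apply: (allP sD); case: k k_int {ekw} => // k k_int.
  by rewrite /p /= nth_rcons ifT ?mem_nth //; lia.
have sub : [set p k.-1; p k.+1] \subset [set u in A | adj (p k) u].
  apply/subsetP=> u /set2P[]->; rewrite inE pA ?step //=; try lia.
  have := step k.-1; rewrite prednK; last lia.
  by rewrite adj_sym; apply; lia.
(* The two neighbors along the ear are distinct, so they fill the neighborhood of size 2. *)
have card2 : #|[set p k.-1; p k.+1]| = 2.
  by rewrite cards2 nth_uniq ?sz //; lia.
have /eqP def_N : [set p k.-1; p k.+1] == [set u in A | adj (p k) u].
  by rewrite eqEcard sub card2 -(eqP deg_k) /deg leqnn.
by apply/set2P; rewrite def_N inE wA.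
Qed.

(* Interior positions of an ear of length [L], ranked so that the center [m] is
   smallest and each arm increases towards it; the arms get even and odd values. *)
Definition ear_rank L m k :=
  if k == m then 0 else if k < m then 2 * k else (2 * (L - k)).+1.

Lemma ear_rank_inj L m j k : 0 < j < L -> 0 < k < L ->
  ear_rank L m j = ear_rank L m k -> j = k.
Proof.
by rewrite /ear_rank; case: (ltngtP j m) => ?; case: (ltngtP k m) => ?; lia.
Qed.

Lemma ear_rank_left L m j k : j < m -> k < m ->
  (ear_rank L m j < ear_rank L m k) = (j < k).
Proof. by move=> lt_jm lt_km; rewrite /ear_rank !ltn_eqF // lt_jm lt_km ltn_mul2l. Qed.

Lemma ear_rank_right L m j k : m < j < L -> m < k < L ->
  (ear_rank L m j < ear_rank L m k) = (k < j).
Proof.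
rewrite /ear_rank => j_int k_int.
by case: (ltngtP j m) => ?; case: (ltngtP k m) => ?; lia.
Qed.

(** Injectivity is asked on [A] only, because vertices not yet restored carry arbitrary ranks. *)
Lemma pdeg_order (G : graph) (A : {set V G}) q : 0 < q -> pdeg (2 * q) A ->
  exists2 rk : V G -> nat, {in A &, injective rk} &
    forall i v, i < q -> v \in A -> #|wset (@adj G) rk A i v| <= reach_bound q i.
Proof.
move=> q_gt0; elim=> {A} [|A v vA deg_v _ [rk rk_inj bnd]|A x mid y ear le_q _ [rk rk_inj bnd]].
- by exists (fun=> 0) => [u v | i v _]; rewrite inE.
- pose N := (\max_u rk u).+1.
  have rk_ltN u : rk u < N by rewrite ltnS leq_bigmax.
  pose rk' u := if u == v then N else rk u.
  have rk_old : {in A :\ v, rk' =1 rk} by move=> u /setD1P[/negbTE uv _]; rewrite /rk' uv.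
  have rk_new w : w \in A :\ v -> rk' w < rk' v.
    by move=> wA'; rewrite rk_old // /rk' eqxx.
  exists rk' => [a b aA bA | i w lt_iq].
    case: (eqVneq a v) (eqVneq b v) => [->|av] [->|bv] // eq_ab.
    + by have := rk_new b; rewrite in_setD1 bv bA eq_ab ltnn => /(_ isT).
    + by have := rk_new a; rewrite in_setD1 av aA eq_ab ltnn => /(_ isT).
    by apply: rk_inj; rewrite ?in_setD1 ?av ?bv // -!rk_old // in_setD1 ?av ?bv.
  apply: (card_wset_pendant (@adj_sym G) (@adj_irr G) vA _ rk_old rk_new lt_iq).
    move=> a b aA bA eva evb; apply/eqP; rewrite -[_ == _]negbK; apply/negP=> neq_ab.
    suff : 1 < deg A v by lia.
    have <- : #|[set a; b]| = 2 by rewrite cards2 neq_ab.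
    by apply/subset_leq_card/subsetP=> u /set2P[]->; rewrite inE ?aA ?bA.
  by move=> j u le_ji; apply: bnd; lia.
have nbr := strict_ear_nbr ear.
have /and4P[sA sU sP sD] := ear.
set L := (size mid).+1 in le_q nbr; set p := nth x (x :: rcons mid y) in nbr.
have sz : size (x :: rcons mid y) = L.+1 by rewrite /= size_rcons.
have [m [m_int le_qm le_qLm]] : exists m, [/\ 0 < m < L, q <= m & q <= L - m].
  (* The center lies at distance [q] from [y]; [2 * q <= L] leaves at least [q] on the side of
     [x]. *)
  by exists (L - q); clear - q_gt0 le_q; split; lia.
have left_int k : 0 < k < m -> 0 < k < L by clear - m_int; lia.
have right_int k : m < k < L -> 0 < k < L by clear - m_int; lia.
have pA j : j <= L -> p j \in A.
  by move=> le_j; apply: (allP sA); rewrite mem_nth ?sz.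
have p_mid k : 0 < k < L -> p k = nth x mid k.-1 /\ k.-1 < size mid.
  by case: k => // k lt_k; rewrite /p /= nth_rcons ifT //; lia.
have mid_p z : z \in mid -> exists2 k, 0 < k < L & z = p k.
  move=> z_mid; have lt_k : index z mid < size mid by rewrite index_mem.
  exists (index z mid).+1; first lia.
  by rewrite /p /= nth_rcons lt_k nth_index.
have mid_uniq : uniq mid by move: sU; rewrite /= rcons_uniq => /and3P[].
have p_index k : 0 < k < L -> p k \in mid /\ index (p k) mid = k.-1.
  by move=> k_int; have [-> lt_k] := p_mid k k_int; rewrite mem_nth // index_uniq.
have [x_mid y_mid] : x \notin mid /\ y \notin mid.
  by move: sU; rewrite /= mem_rcons inE negb_or rcons_uniq => /andP[/andP[_ ->] /andP[->]].
pose N := (\max_u rk u).+1.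
have rk_ltN u : rk u < N by rewrite ltnS leq_bigmax.
(* The shift by [N] puts the interior after all old vertices. Position 0 of the ear is [x], hence
   the successor of the index in [mid]. *)
pose rk' u := if u \in mid then N + ear_rank L m (index u mid).+1 else rk u.
have rk'_p k : 0 < k < L -> rk' (p k) = N + ear_rank L m k.
  move=> k_int; have [k_mid k_idx] := p_index k k_int.
  by rewrite /rk' k_mid k_idx prednK //; case/andP: k_int.
have rk_old : {in A :\: [set z in mid], rk' =1 rk}.
  by move=> u /setDP[_]; rewrite inE /rk' => /negbTE->.
have rk_new k w : 0 < k < L -> w \in A :\: [set z in mid] -> rk' w < rk' (p k).
  by move=> k_int wA'; rewrite rk_old // rk'_p // ltn_addr.
have A_cases u : u \in A -> u \in A :\: [set z in mid] \/ exists2 k, 0 < k < L & u = p k.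
  move=> uA; case u_mid: (u \in mid); first by right; apply: mid_p.
  by left; rewrite !inE u_mid.
exists rk' => [a b aA bA | i w lt_iq].
  case: (A_cases a aA) (A_cases b bA) => [aA' | [j j_int ->]] [bA' | [k k_int ->]] eq_ab.
  + by apply: rk_inj; rewrite // -!rk_old.
  + by have := rk_new k a k_int aA'; rewrite eq_ab ltnn.
  + by have := rk_new j b j_int bA'; rewrite eq_ab ltnn.
  congr p; move: eq_ab; rewrite !rk'_p // => /addnI; exact: ear_rank_inj.
have p0 : p 0 \in A :\: [set z in mid] by rewrite in_setD inE pA //= andbT.
have pL : p L \in A :\: [set z in mid].
  by rewrite in_setD inE pA // /p /= nth_rcons ltnn eqxx y_mid.
apply: (card_wset_ear (@adj_sym G) m_int p0 pL _ A_cases _ _ nbr rk_old rk_new _ _ _ _ _ lt_iq).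
- by move=> k k_int; rewrite in_setD inE; have [-> _] := p_index k k_int.
- exact: subsetDl.
- by move=> k /andP[_ lt_kL]; rewrite pA // ltnW.
- by move=> k k_int; rewrite !rk'_p // leq_add2l /ear_rank eqxx.
- move=> j k j_int k_int; rewrite !rk'_p ?left_int // ltn_add2l.
  by case/andP: j_int k_int => _ lt_jm /andP[_ lt_km]; rewrite ear_rank_left.
- move=> j k j_int k_int; rewrite !rk'_p ?right_int // ltn_add2l.
  by rewrite ear_rank_right.
- exact: le_qm.
- exact: le_qLm.
by move=> j u le_ji; apply/bnd/(leq_ltn_trans le_ji).
Qed.

Lemma wcol_path_degenerate (G : graph) q r : r < q ->
  path_degenerate G (2 * q) -> wcol G r <= reach_bound q r.
Proof.
move=> lt_rq /(pdeg_order (leq_ltn_trans (leq0n r) lt_rq))[rk rk_inj bnd].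
have rk_injT : injective rk by move=> u v; apply: rk_inj; rewrite inE.
by apply: (wcol_le rk_injT) => v; apply: bnd; rewrite ?inE.
Qed.

Theorem mainTheorem19 (r : nat) (C : graph -> Prop) (g : nat -> nat)
  (hr : 1 <= r) (hC : subexp_expansion C)
  (hg : forall p, 2 <= p -> forall G, C G -> girth_ge G (g p) -> path_degenerate G p) :
  forall G, C G ->
    (forall q, r < q < 2 * r -> girth_ge G (g (2 * q)) ->
       wcol G r <= r + 2 + trunc_log 2 ((q - 1) %/ (q - r)))
    /\ (girth_ge G (g (4 * r)) -> wcol G r <= r + 2).
Proof.
have boundE q : reach_bound q r = r + 2 + trunc_log 2 ((q - 1) %/ (q - r)).
  by case: r hr.
move=> G CG; split=> [q /andP[lt_rq _] girth_G | girth_G].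
  by rewrite -boundE; apply: wcol_path_degenerate => //; apply: hg girth_G => //; lia.
(* The formula of (i) at [q = 2r], where the logarithm vanishes. *)
have -> : r + 2 = reach_bound (2 * r) r.
  have lt2 : (2 * r - 1) %/ (2 * r - r) < 2 by rewrite ltn_divLR; lia.
  by rewrite boundE; case: (_ %/ _) lt2 => [|[|]] //= _; rewrite ?trunc_log0 ?trunc_log1 addn0.
apply: wcol_path_degenerate; first lia.
by apply: hg => //; [lia | rewrite mulnA].
Qed.
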